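(* For $p=1,2$ let $W_p$ be a finite-dimensional real vector space, let $\varphi_p$ be a nondegenerate symmetric bilinear form on $W_p$, let $k_p\ge 1$, and let $(V_p,R_p)=\bigoplus_{i=1}^{k_p}(W_p,R_{\varphi_p})$. Let $(V,R)=(V_1,R_1)\oplus(V_2,R_2)$, and assume $\ker R=0$. If $\dim W_1\ne\dim W_2$, then $G_R\cong (G_{R_{\varphi_1}}\wr S_{k_1})\times(G_{R_{\varphi_2}}\wr S_{k_2})$.
   Context: For a symmetric bilinear form $\varphi$, $R_\varphi(x,y,z,w)=\varphi(x,w)\varphi(y,z)-\varphi(x,z)\varphi(y,w)$. A direct sum $\bigoplus_i (U_i,T_i)$ of vector spaces with 4-linear forms is the pair $(U,T)$ with $U=\bigoplus_i U_i$ and $T(x,y,z,w)=\sum_i T_i(x_i,y_i,z_i,w_i)$, where $x_i$ is the $U_i$-component of $x$, etc. $\ker R=\{v\in V: R(v,x,y,z)=0\ \text{for all } x,y,z\in V\}$. For a 4-linear form $T$ on a vector space $U$, $G_T=\{A\in GL(U): T(Ax,Ay,Az,Aw)=T(x,y,z,w)\ \text{for all } x,y,z,w\in U\}$. For a group $G$, the wreath product $G\wr S_k$ is the semidirect product $G^k\rtimes S_k$ with multiplication $(h_1,\dots,h_k;\tau)(g_1,\dots,g_k;\sigma)=(h_1g_{\tau^{-1}(1)},\dots,h_kg_{\tau^{-1}(k)};\tau\sigma)$, where $S_k$ is the symmetric group on $\{1,\dots,k\}$.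
   Formalization: The spaces $W_1$ and $W_2$ are assumed nonzero; otherwise, e.g. for $W_1=0$, $k_1=2$, $W_2=\mathbb{R}^2$, $k_2=1$, the right-hand side has an extra factor $S_2$ and the claim fails. *)

(* Defs.v *)
From HB Require Import structures.
From mathcomp Require Import all_boot all_order all_algebra all_fingroup.
From mathcomp Require Import boolp classical_sets reals.

Set Implicit Arguments.
Unset Strict Implicit.
Unset Printing Implicit Defensive.

Import GRing.Theory.
Local Open Scope ring_scope.

(* Multilinearity is not part of the type: every form used below is built from
   bilinear forms and hence 4-linear. *)
Definition form4 (R : realType) (U : vectType R) := U -> U -> U -> U -> R.

Definition curv (R : realType) (W : vectType R) (phi : {symmetric W}) :
    form4 W :=
  fun x y z w => phi x w * phi y z - phi x z * phi y w.

(* The direct sum of a family of forms on copies of U indexed by a finite type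
   I; its underlying vector space is {ffun I -> U}. *)
Definition dsum_family (R : realType) (I : finType) (U : vectType R)
    (T : I -> form4 U) : form4 {ffun I -> U} :=
  fun x y z w => \sum_(i : I) T i (x i) (y i) (z i) (w i).

Definition dsum_pair (R : realType) (U1 U2 : vectType R)
    (T1 : form4 U1) (T2 : form4 U2) : form4 (U1 * U2)%type :=
  fun x y z w => T1 x.1 y.1 z.1 w.1 + T2 x.2 y.2 z.2 w.2.

Definition form4_ker (R : realType) (U : vectType R) (T : form4 U) : set U :=
  [set v | forall x y z, T v x y z = 0].

(* As U is finite-dimensional, injective
    endomorphisms are invertible. *)
Section GeneralLinear.
Variables (R : realType) (U : vectType R).

Record GL := MkGL { GLfun :> 'End(U); _ : lker GLfun == 0%VS }.

HB.instance Definition _ := [isSub for GLfun].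
HB.instance Definition _ := [Choice of GL by <:].

Fact GL_one_subproof : lker (\1 : 'End(U))%VF == 0%VS.
Proof. by apply/lker0P => x y; rewrite !lfunE. Qed.

Fact GL_mul_subproof (A B : GL) : lker (A \o B)%VF == 0%VS.
Proof.
by apply/lker0P => x y; rewrite !comp_lfunE => /(lker0P (valP A))/(lker0P (valP B)).
Qed.

Fact GL_inv_subproof (A : GL) : lker (A^-1)%VF == 0%VS.
Proof. exact/lker0P/(can_inj (lker0_lfunVK (valP A))). Qed.

Definition GL_one := MkGL GL_one_subproof.
Definition GL_mul A B := MkGL (GL_mul_subproof A B).
Definition GL_inv A := MkGL (GL_inv_subproof A).

Fact GL_mulA : associative GL_mul.
Proof. by move=> A B C; apply/val_inj; rewrite /= comp_lfunA. Qed.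

Fact GL_mul1 : left_id GL_one GL_mul.
Proof. by move=> A; apply/val_inj; rewrite /= comp_lfun1l. Qed.

Fact GL_mulr1 : right_id GL_one GL_mul.
Proof. by move=> A; apply/val_inj; rewrite /= comp_lfun1r. Qed.

Fact GL_mulV : left_inverse GL_one GL_inv GL_mul.
Proof. by move=> A; apply/val_inj; rewrite /= lker0_compVf ?(valP A). Qed.

Fact GL_mulrV : right_inverse GL_one GL_inv GL_mul.
Proof. by move=> A; apply/val_inj; rewrite /= lker0_compfV ?(valP A). Qed.

HB.instance Definition _ :=
  isGroup.Build GL GL_mulA GL_mul1 GL_mulr1 GL_mulV GL_mulrV.

End GeneralLinear.

Section StructureGroup.
Variables (R : realType) (U : vectType R) (T : form4 U).

Definition preserves : pred (GL U) := fun A =>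
  `[< forall x y z w : U, T (A x) (A y) (A z) (A w) = T x y z w >].

Record strgroup := MkStrgroup { strgroup_val :> GL U; _ : preserves strgroup_val }.

HB.instance Definition _ := [isSub for strgroup_val].
HB.instance Definition _ := [Choice of strgroup by <:].

Fact preserves_group_closed : group_closed preserves.
Proof.
split=> [|A B]; first by apply/asboolP => x y z w; rewrite !lfunE.
move=> /asboolP hA /asboolP hB; apply/asboolP => x y z w.
have BK u : B (GL_inv B u) = u by exact: (lker0_lfunVK (valP B)).
by rewrite !comp_lfunE hA -hB !BK.
Qed.

HB.instance Definition _ :=
  SubChoice_isSubGroup.Build (GL U) preserves strgroup preserves_group_closed.

End StructureGroup.

Definition wreath (G : groupType) (k : nat) : Type := ({ffun 'I_k -> G} * 'S_k)%type.

Section Wreath.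
Variables (G : groupType) (k : nat).
Local Open Scope group_scope.

HB.instance Definition _ :=
  Choice.copy (wreath G k) ({ffun 'I_k -> G} * 'S_k)%type.

Implicit Types a b : wreath G k.

Definition wreath_one : wreath G k := ([ffun=> 1], 1).

(* (h; tau) (g; sigma) = (i |-> h_i g_(tau^-1 i); tau \o sigma).  Since the
   product of 'S_k satisfies (s * t) i = t (s i), the composite tau \o sigma is
   sigma * tau. *)
Definition wreath_mul a b : wreath G k :=
  ([ffun i => a.1 i * b.1 (a.2^-1 i)], b.2 * a.2).

Definition wreath_inv a : wreath G k := ([ffun i => (a.1 (a.2 i))^-1], a.2^-1).

Fact wreath_mulA : associative wreath_mul.
Proof.
move=> a b c; congr pair; last by rewrite /= mulgA.
by apply/ffunP=> i; rewrite !ffunE /= invMg permM mulgA.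
Qed.

Fact wreath_mul1 : left_id wreath_one wreath_mul.
Proof.
case=> g s; congr pair; last by rewrite /= mulg1.
by apply/ffunP=> i; rewrite !ffunE /= invg1 perm1 mul1g.
Qed.

Fact wreath_mulr1 : right_id wreath_one wreath_mul.
Proof.
case=> g s; congr pair; last by rewrite /= mul1g.
by apply/ffunP=> i; rewrite !ffunE /= mulg1.
Qed.

Fact wreath_mulV : left_inverse wreath_one wreath_inv wreath_mul.
Proof.
case=> g s; congr pair; last by rewrite /= mulgV.
by apply/ffunP=> i; rewrite !ffunE /= invgK mulVg.
Qed.

Fact wreath_mulrV : right_inverse wreath_one wreath_inv wreath_mul.
Proof.
case=> g s; congr pair; last by rewrite /= mulVg.
by apply/ffunP=> i; rewrite !ffunE /= permKV mulgV.
Qed.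

HB.instance Definition _ := isGroup.Build (wreath G k)
  wreath_mulA wreath_mul1 wreath_mulr1 wreath_mulV wreath_mulrV.

End Wreath.

Definition isomorphic (G H : groupType) : Prop :=
  exists f : {multiplicative G -> H}, bijective f.

(* Main.v *)
Require Import Defs.
From HB Require Import structures.
From mathcomp Require Import all_boot all_order all_algebra all_fingroup.
From mathcomp Require Import boolp classical_sets reals.
Import GRing.Theory.
Local Open Scope ring_scope.

(** Call two vectors x and z of V separated when every block component of x or
    the corresponding component of z vanishes.  The proof rests on reading this
    relation off the form alone: x and z are separated exactly when
    R(x, y, y', z) = 0 for all y and y'.  Blockwise this says that
    R_phi(x, ., ., z) vanishes only if x = 0 or z = 0 ([curv_eq0P]), which holds
    once R_phi has trivial kernel, that is, once phi is nondegenerate on a space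
    of dimension at least 2; triviality of ker R passes to every block
    ([form4_ker_block_in]).

    An isometry A of R therefore preserves separation.  A vector inside a block
    is not a sum of two nonzero separated vectors, so its image lies in one
    block; two nonzero vectors of the same block are not separated, so this
    target block is the same for the whole block, and vectors of distinct blocks
    are separated, so distinct blocks have distinct targets.  Hence A permutes
    the blocks ([isometry_perm_blocks]) and matches only blocks of equal
    dimension ([isometry_perm_dim]).  As W1 and W2 have different dimensions,
    the copies of W1 are permuted among themselves, and so are the copies of W2;
    on each copy A is an isometry of R_phi ([isometry_block_family]).

    In the other direction, a pair of wreath product elements acts on V by
    permuting the copies of each W_p and applying isometries of R_phi_p to them.
    This gives a group morphism into G_R, injective because the W_p are nonzero
    and surjective by the above ([pair_act_strgroup_surj]); its inverse is the
    isomorphism. *)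

Set Implicit Arguments.
Unset Strict Implicit.
Unset Printing Implicit Defensive.

(** * Curvature forms with trivial kernel *)

Section CurvatureForm.
Variables (R : realType) (W : vectType R) (phi : {symmetric W}).
Hypothesis curv_ker : forall v, (forall x y z, curv phi v x y z = 0) -> v = 0.

Lemma symmetric_formC x y : phi x y = phi y x.
Proof. by rewrite hermC expr0 mul1r. Qed.

Lemma symmetric_form_nondeg v : (forall y, phi v y = 0) -> v = 0.
Proof. by move=> v0; apply: curv_ker => x y z; rewrite /curv !v0 !mul0r subrr. Qed.

(** If phi x z = 0 the form is the product - phi x y' * phi y z.  Otherwise it is
    a nonzero multiple of phi y y' minus a form of rank one in (y, y'), which
    cannot vanish in dimension at least 2. *)
Lemma curv_eq0P x z :
  (forall y y', curv phi x y y' z = 0) <-> (x == 0) || (z == 0).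
Proof.
split=> [xz0|/orP[]/eqP-> y y']; last 2 first.
- by rewrite /curv !linear0l !mul0r subrr.
- by rewrite /curv !linear0r mul0r mulr0 subrr.
apply/norP => -[x0 z0].
have [c0|c0] := eqVneq (phi x z) 0.
  have xz y y' : phi x y' * phi y z = 0.
    have /eqP := xz0 y y'.
    by rewrite /curv c0 mul0r sub0r oppr_eq0 => /eqP.
  move/negP: x0; apply; apply/eqP/symmetric_form_nondeg => y'; apply/eqP/negPn.
  apply/negP => xy'; move/negP: z0; apply; apply/eqP/symmetric_form_nondeg => y.
  rewrite symmetric_formC; apply/eqP; have /eqP := xz y y'.
  by rewrite mulf_eq0 (negPf xy').
(* The hyperplane orthogonal to z would lie in the radical of phi, so W would be
   the line spanned by x. *)
have orth0 y : phi y z = 0 -> y = 0.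
  move=> yz0; apply: symmetric_form_nondeg => y'; apply/eqP.
  have /eqP := xz0 y y'; rewrite /curv yz0 mulr0 subr0 mulf_eq0.
  by rewrite (negPf c0).
have line a : a = (phi a z / phi x z) *: x.
  apply/eqP; rewrite -subr_eq0; apply/eqP/orth0.
  by rewrite linearBl linearZl_LR divfK // subrr.
move/negP: x0; apply; apply/eqP/curv_ker => a b d.
rewrite (line a) /curv !linearZl_LR /=.
by rewrite mulrCA mulrA [phi x b * _]mulrCA mulrC [_ * (_ * phi x d)]mulrCA subrr.
Qed.

End CurvatureForm.

(** * Isometries of a direct sum permute its blocks *)

Section BlockPermutation.
Variables (R : realType) (V : vectType R) (J : finType) (W : J -> vectType R).
Variables (inj : forall j, 'Hom(W j, V)) (prj : forall j, 'Hom(V, W j)).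
Hypothesis injK : forall j, cancel (inj j) (prj j).
Hypothesis prj_inj_neq : forall i j w, i != j -> prj i (inj j w) = 0.
Hypothesis sum_inj_prj : forall x, \sum_j inj j (prj j x) = x.
Hypothesis W_neq0 : forall j, exists w : W j, w != 0.
Variable T : forall j, form4 (W j).
Hypothesis TP : forall j (x z : W j),
  (forall y y', T x y y' z = 0) <-> (x == 0) || (z == 0).
Variable Q : form4 V.
Hypothesis QE : forall x y z w,
  Q x y z w = \sum_j T (prj j x) (prj j y) (prj j z) (prj j w).

Hypothesis T0 : forall j x y z, T x (0 : W j) y z = 0.

(** Disjointness of the block supports. *)
Definition separated (x z : V) := forall j, (prj j x == 0) || (prj j z == 0).

(** The right-hand side mentions the form only, which is what makes separation
    an isometry invariant. *)
Lemma separatedP x z : separated x z <-> (forall y y', Q x y y' z = 0).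
Proof.
split=> [xz y y'|Qxz j].
  by rewrite QE big1 // => j _; have /TP := xz j.
apply/TP => w w'; have := Qxz (inj j w) (inj j w').
rewrite QE (bigD1 j) //= !injK big1 ?addr0 // => i ij.
by rewrite prj_inj_neq.
Qed.

Lemma form_inj j x y z w :
  Q (inj j x) (inj j y) (inj j z) (inj j w) = T x y z w.
Proof.
by rewrite QE (bigD1 j) //= !injK big1 ?addr0 // => i ij; rewrite !prj_inj_neq.
Qed.

Lemma eq_prj x y : (forall j, prj j x = prj j y) -> x = y.
Proof.
by move=> xy; rewrite -[x]sum_inj_prj -[y]sum_inj_prj; apply: eq_bigr => j _;
   rewrite xy.
Qed.

Variable A : 'End(V).
Hypothesis A_inj : lker A == 0%VS.
Hypothesis AQ : forall x y z w, Q (A x) (A y) (A z) (A w) = Q x y z w.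

Lemma separated_isometry x z : separated (A x) (A z) <-> separated x z.
Proof.
split=> /separatedP xz; apply/separatedP => y y'; first by rewrite -AQ.
by rewrite -[y](lker0_lfunVK A_inj) -[y'](lker0_lfunVK A_inj) AQ.
Qed.

(** The component of the image in the block b and the remainder of the image are
    separated, hence so are their preimages; these add up to a vector of a single
    block, so one of them is zero, and it is not the first. *)
Lemma isometry_inj_in_block j (w : W j) b :
  prj b (A (inj j w)) != 0 -> A (inj j w) = inj b (prj b (A (inj j w))).
Proof.
set y := A _ => yb; pose u := (A^-1)%VF (inj b (prj b y)).
have Au : A u = inj b (prj b y) by rewrite /u (lker0_lfunVK A_inj).
have suv : separated u (inj j w - u).
  apply/separated_isometry => i; rewrite linearB /= Au -/y.
  have [->|ib] := eqVneq i b; first by rewrite linearB /= injK subrr eqxx orbT.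
  by rewrite prj_inj_neq // eqxx.
(* In any other block the components of u and of inj j w - u add up to zero and
   one of them vanishes, so both do. *)
have u_out i : i != j -> prj i u = 0.
  move=> ij; have := suv i; rewrite linearB /= prj_inj_neq // sub0r oppr_eq0.
  by rewrite orbb => /eqP.
have := suv j; rewrite linearB /= injK => /orP[/eqP uj|/eqP uj].
  have u0 : u = 0.
    by apply: eq_prj => i; rewrite linear0; have [->|/u_out] := eqVneq i j.
  by move: yb; rewrite -(injK (prj b y)) -Au u0 !linear0 eqxx.
rewrite -Au; congr (A _); apply: eq_prj => i.
have [->|ij] := eqVneq i j; last by rewrite u_out // prj_inj_neq.
by rewrite injK; apply/eqP; rewrite -subr_eq0 uj.
Qed.

Lemma isometry_inj_eq0 j (w : W j) : A (inj j w) = 0 -> w = 0.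
Proof.
by move=> Aw; rewrite -(injK w) -[inj j w](lker0_lfunK A_inj) Aw !linear0.
Qed.

Lemma neq0_prj y : y != 0 -> exists b, prj b y != 0.
Proof.
move=> y0; apply/existsP; apply: contraNT y0; rewrite negb_exists => /forallP y0.
by apply/eqP/eq_prj => b; rewrite linear0; apply/eqP/negPn.
Qed.

(** A nonzero vector e of the block j determines the target of the whole block:
    no other nonzero vector of that block is separated from e. *)
Lemma isometry_perm_blocks : exists s : {perm J},
  forall j x, A (inj j (prj j x)) = inj (s j) (prj (s j) (A x)).
Proof.
have neqA j (w : W j) : w != 0 -> exists b, prj b (A (inj j w)) != 0.
  by move=> w0; apply: neq0_prj; apply: contra_neq w0 => /isometry_inj_eq0.
have /fin_all_exists[s sP] : forall j, exists b, forall w : W j,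
    A (inj j w) = inj b (prj b (A (inj j w))).
  move=> j; have [e e0] := W_neq0 j; have [b eb] := neqA j e e0; exists b => w.
  have [->|w0] := eqVneq w 0; first by rewrite !linear0.
  have [b' wb'] := neqA j w w0.
  suff bb' : b' = b by rewrite -bb'; apply: isometry_inj_in_block.
  apply/eqP/negPn/negP => nbb'.
  have /separated_isometry/(_ j) : separated (A (inj j e)) (A (inj j w)).
    rewrite (isometry_inj_in_block eb) (isometry_inj_in_block wb') => i.
    have [ib|ib] := eqVneq i b; last by rewrite [prj i _]prj_inj_neq ?eqxx.
    by rewrite [X in _ || (X == 0)]prj_inj_neq ?eqxx ?orbT // ib eq_sym.
  by rewrite !injK (negPf e0) (negPf w0).
have s_inj : injective s.
  move=> i j sij; apply/eqP/negPn/negP => nij.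
  have [e e0] := W_neq0 i; have [f f0] := W_neq0 j.
  have /separated_isometry/(_ (s j)) : separated (inj i e) (inj j f).
    move=> l; have [->|li] := eqVneq l i.
      by rewrite [X in _ || (X == 0)]prj_inj_neq ?eqxx ?orbT.
    by rewrite prj_inj_neq ?eqxx.
  have nz l (w : W l) : w != 0 -> prj (s l) (A (inj l w)) != 0.
    move=> w0; apply: contra_neq w0 => w0; apply: isometry_inj_eq0.
    by rewrite sP w0 linear0.
  by have := nz i e e0; rewrite sij => /negPf->; rewrite (negPf (nz j f f0)).
exists (perm s_inj) => j x; rewrite !permE.
rewrite -[x in RHS]sum_inj_prj !linear_sum (bigD1 j) //=.
rewrite -sP big1 ?addr0 // => i ij.
by rewrite sP prj_inj_neq ?linear0 // (inj_eq s_inj) eq_sym.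
Qed.

(** A conjugates the projector of V onto the block j to the projector onto the
    block s j, so the two have the same rank. *)
Lemma isometry_perm_dim (s : {perm J}) :
    (forall j x, A (inj j (prj j x)) = inj (s j) (prj (s j) (A x))) ->
  forall j, \dim {: W (s j)} = \dim {: W j}.
Proof.
move=> sP j.
have dimE i : \dim (limg (inj i \o prj i)) = \dim {: W i}.
  have -> : limg (inj i \o prj i) = limg (inj i).
    rewrite limg_comp; congr (_ @: _)%VS; apply/eqP; rewrite eqEsubv subvf.
    by apply/subvP => w _; rewrite -(injK w) memv_img ?memvf.
  apply: limg_dim_eq; rewrite capfv; apply/eqP.
  exact/lker0P/(can_inj (@injK i)).
have AE : (A \o (inj j \o prj j) = (inj (s j) \o prj (s j)) \o A)%VF.
  by apply/lfunP => x; rewrite !comp_lfunE sP.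
rewrite -!dimE -[RHS](@limg_dim_eq _ _ _ A); last by rewrite (eqP A_inj) capv0.
by rewrite -[(A @: _)%VS]limg_comp AE [in RHS]limg_comp (lker0_limgf A_inj).
Qed.

End BlockPermutation.

(** * Isometries permuting isometric copies of one space *)

Section BlockFamily.
Variables (R : realType) (V U : vectType R) (I : finType).
Variables (inj : I -> 'Hom(U, V)) (prj : I -> 'Hom(V, U)).
Hypothesis injK : forall i, cancel (inj i) (prj i).
Variables (Q : form4 V) (T : form4 U).
Hypothesis QT : forall i x y z w,
  Q (inj i x) (inj i y) (inj i z) (inj i w) = T x y z w.
Variables (A : 'End(V)) (s : {perm I}).
Hypothesis A_inj : lker A == 0%VS.
Hypothesis AQ : forall x y z w, Q (A x) (A y) (A z) (A w) = Q x y z w.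
Hypothesis sP : forall i w, A (inj i w) = inj (s i) (prj (s i) (A (inj i w))).

(** The isometries are indexed by the target block, in agreement with the product
    of the wreath group, where (h; s) sends the block i to the block s i by
    h (s i). *)
Lemma isometry_block_family :
  exists h : {ffun I -> strgroup T},
    forall i w, A (inj i w) = inj (s i) (h (s i) w).
Proof.
have /fin_all_exists[h hP] : forall b, exists g : strgroup T,
    forall w, A (inj (s^-1%g b) w) = inj b (g w).
  move=> b; set i := (s^-1)%g b.
  have si : s i = b by rewrite /i permKV.
  pose f := (prj b \o A \o inj i)%VF.
  have fE w : inj b (f w) = A (inj i w) by rewrite !comp_lfunE /= [RHS]sP si.
  have f_inj : lker f == 0%VS.
    apply/lker0P => x y fxy; apply: (can_inj (@injK i)); apply: (lker0P A_inj).
    by rewrite -!fE fxy.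
  have fT : preserves T (MkGL f_inj).
    by apply/asboolP => x y z w /=; rewrite -(QT b) !fE AQ QT.
  by exists (MkStrgroup fT) => w /=; rewrite fE.
by exists [ffun b => h b] => i w; rewrite ffunE -hP permK.
Qed.

End BlockFamily.

(** * The action of the wreath product on a sum of copies *)

Section SingleSupport.
Variables (R : realType) (I : finType) (U : vectType R).

Definition single (i : I) (w : U) : {ffun I -> U} :=
  [ffun l => if l == i then w else 0].

Lemma single_is_linear (i : I) : linear (single i).
Proof.
move=> c x y; apply/ffunP=> l; rewrite !ffunE.
by case: eqP; rewrite // scaler0 addr0.
Qed.

Lemma sum_single (x : {ffun I -> U}) : \sum_i single i (x i) = x.
Proof.
apply/ffunP => l; rewrite sum_ffunE (bigD1 l) //= ffunE eqxx big1 ?addr0 // => i il.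
by rewrite ffunE eq_sym ifN.
Qed.

End SingleSupport.

Section WreathAction.
Variables (R : realType) (U : vectType R) (T : form4 U) (k : nat).
Implicit Types (a b : wreath (strgroup T) k) (x : {ffun 'I_k -> U}).

Definition wreath_act a x : {ffun 'I_k -> U} :=
  [ffun i => a.1 i (x ((a.2)^-1%g i))].

Lemma wreath_act_is_linear a : linear (wreath_act a).
Proof. by move=> c x y; apply/ffunP=> i; rewrite !ffunE linearP. Qed.

Lemma wreath_act1 x : wreath_act 1%g x = x.
Proof. by apply/ffunP=> i; rewrite !ffunE /= invg1 perm1 lfunE. Qed.

Lemma wreath_actM a b x : wreath_act (a * b)%g x = wreath_act a (wreath_act b x).
Proof. by apply/ffunP=> i; rewrite !ffunE /= lfunE /= invMg permM. Qed.

Lemma wreath_act_preserves a x y z w :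
  dsum_family (fun=> T) (wreath_act a x) (wreath_act a y) (wreath_act a z)
    (wreath_act a w)
  = dsum_family (fun=> T) x y z w.
Proof.
rewrite /dsum_family (reindex_perm a.2); apply: eq_bigr => i _.
by rewrite !ffunE !permK; have /asboolP-> := valP (a.1 (a.2 i)).
Qed.

Lemma wreath_act0 a : wreath_act a 0 = 0.
Proof. by apply/ffunP=> i; rewrite !ffunE linear0. Qed.

Lemma wreath_act_single a i w :
  wreath_act a (single i w) = single (a.2 i) (a.1 (a.2 i) w).
Proof.
apply/ffunP=> l; rewrite !ffunE (can2_eq (permKV _) (permK _)).
by case: eqP => [->|]; rewrite ?linear0.
Qed.

(** Vectors with one nonzero entry recover the permutation from the position of
    the nonzero entry of the image, and then the isometries from its value. *)
Lemma wreath_act_faithful a b :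
  (exists w : U, w != 0) -> wreath_act a =1 wreath_act b -> a = b.
Proof.
move=> [w0 w0_neq0] ab.
have ab2 : a.2 = b.2.
  apply/permP => j; have /ffunP/(_ (a.2 j)) := ab (single j w0).
  rewrite !ffunE permK eqxx; case: eqP => [bj _|_].
    by rewrite -[in RHS]bj permKV.
  rewrite linear0 => aw0; case/eqP: w0_neq0.
  apply: (lker0P (valP (val (a.1 (a.2 j))))).
  by rewrite /= linear0.
case: a b ab ab2 => [g s] [h t] /= ab st; rewrite -{t}st in ab *; congr pair.
apply/ffunP => i; do 2!apply: val_inj; apply/lfunP => w.
have /ffunP/(_ i) := ab (single ((s^-1)%g i) w).
by rewrite !ffunE eqxx.
Qed.

End WreathAction.

(** * The morphism from the product of wreath products *)

Section ProductAction.
Variables (R : realType) (U1 U2 : vectType R) (T1 : form4 U1) (T2 : form4 U2).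
Variables (k1 k2 : nat).
Local Notation V := ({ffun 'I_k1 -> U1} * {ffun 'I_k2 -> U2})%type.
Local Notation H := (wreath (strgroup T1) k1 * wreath (strgroup T2) k2)%type.
Local Notation Q :=
  (dsum_pair (dsum_family (fun=> T1)) (dsum_family (fun=> T2)) : form4 V).

Definition pair_act (a : H) (x : V) : V := (wreath_act a.1 x.1, wreath_act a.2 x.2).

Lemma pair_act_is_linear a : linear (pair_act a).
Proof. by move=> c x y; congr pair; rewrite wreath_act_is_linear. Qed.

HB.instance Definition _ a :=
  GRing.isLinear.Build R V V _ (pair_act a) (pair_act_is_linear a).

Lemma pair_actM a b x : pair_act (a * b)%g x = pair_act a (pair_act b x).
Proof. by congr pair; rewrite wreath_actM. Qed.

Lemma pair_act1 x : pair_act 1%g x = x.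
Proof. by case: x => x y; congr pair; rewrite wreath_act1. Qed.

Lemma pair_act_ker a : lker (linfun (pair_act a)) == 0%VS.
Proof.
apply/lker0P/(@can_inj _ _ _ (pair_act a^-1%g)) => x.
by rewrite lfunE -pair_actM mulVg pair_act1.
Qed.

Lemma pair_act_preserves a : preserves Q (MkGL (pair_act_ker a)).
Proof.
have actE x : MkGL (pair_act_ker a) x = pair_act a x by exact: lfunE.
by apply/asboolP => x y z w; rewrite !actE /dsum_pair !wreath_act_preserves.
Qed.

Definition pair_act_strgroup a : strgroup Q := MkStrgroup (pair_act_preserves a).

Lemma pair_act_strgroupE a x : pair_act_strgroup a x = pair_act a x.
Proof. exact: lfunE. Qed.

Lemma eq_strgroup (A B : strgroup Q) : A =1 B -> A = B.
Proof. by move=> AB; do 2!apply: val_inj; apply/lfunP. Qed.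

Lemma pair_act_strgroupM : {morph pair_act_strgroup : a b / (a * b)%g}.
Proof.
move=> a b; apply: eq_strgroup => x.
rewrite pair_act_strgroupE pair_actM -!pair_act_strgroupE.
exact/esym/comp_lfunE.
Qed.

Hypotheses (U1_neq0 : exists w : U1, w != 0) (U2_neq0 : exists w : U2, w != 0).

Lemma pair_act_strgroup_inj : injective pair_act_strgroup.
Proof.
move=> [a1 a2] [b1 b2] ab.
have abx x : pair_act (a1, a2) x = pair_act (b1, b2) x.
  by rewrite -!pair_act_strgroupE ab.
congr pair; apply: wreath_act_faithful => // x.
  by case: (abx (x, 0)).
by case: (abx (0, x)).
Qed.

End ProductAction.

Lemma isomorphic_bij (G H : groupType) (f : G -> H) :
  {morph f : x y / (x * y)%g} -> injective f -> (forall y, exists x, f x = y) ->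
  isomorphic H G.
Proof.
move=> fM f_inj /choice[g gK].
have fK : cancel f g by move=> x; apply: f_inj.
have gM : {morph g : x y / (x * y)%g}.
  by move=> x y; apply: f_inj; rewrite fM !gK.
pose gm := isMultiplicative.Build H G g gM.
pose g' : {multiplicative H -> G} := HB.pack g gm.
by exists g'; exists f.
Qed.

(** * Surjectivity for blocks of two different dimensions *)

Section TwoTypes.
Variables (R : realType) (U1 U2 : vectType R) (T1 : form4 U1) (T2 : form4 U2).
Variables (k1 k2 : nat).
Local Notation V := ({ffun 'I_k1 -> U1} * {ffun 'I_k2 -> U2})%type.
Local Notation J := ('I_k1 + 'I_k2)%type.
Local Notation Q :=
  (dsum_pair (dsum_family (fun=> T1)) (dsum_family (fun=> T2)) : form4 V).

(** Indexing the copies of both spaces by one sum type presents V as a single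
    direct sum, with blocks of varying type. *)
Definition block_type (j : J) : vectType R := if j is inl _ then U1 else U2.

Definition block_form (j : J) : form4 (block_type j) :=
  match j with inl _ => T1 | inr _ => T2 end.

Definition block_in (j : J) : block_type j -> V :=
  match j with
  | inl i => fun w => (single i w, 0)
  | inr i => fun w => (0, single i w)
  end.

Definition block_out (j : J) : V -> block_type j :=
  match j with inl i => fun x => x.1 i | inr i => fun x => x.2 i end.

Lemma block_in_is_linear j : linear (@block_in j).
Proof.
case: j => i c x y; rewrite /= single_is_linear.
  by rewrite -[RHS]/(_, c *: 0 + 0) scaler0 addr0.
by rewrite -[RHS]/(c *: 0 + 0, _) scaler0 addr0.
Qed.

Lemma block_out_is_linear j : linear (@block_out j).
Proof. by case: j => i c x y; rewrite /= !ffunE. Qed.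

HB.instance Definition _ j := GRing.isLinear.Build R (block_type j) V _
  (@block_in j) (@block_in_is_linear j).
HB.instance Definition _ j := GRing.isLinear.Build R V (block_type j) _
  (@block_out j) (@block_out_is_linear j).

Lemma block_inK j : cancel (linfun (@block_in j)) (linfun (@block_out j)).
Proof. by move=> w; rewrite !lfunE; case: j w => i w /=; rewrite ffunE eqxx. Qed.

Lemma block_in_eq0 j (v : block_type j) : block_in v = 0 -> v = 0.
Proof.
case: j v => i v /= => [/(congr1 fst)|/(congr1 snd)] /= /ffunP/(_ i);
  by rewrite !ffunE eqxx.
Qed.

Lemma block_out_in_neq i j w :
  i != j -> linfun (@block_out i) (linfun (@block_in j) w) = 0.
Proof.
by rewrite !lfunE; case: i j w => i [] j w //= ij; rewrite ffunE // ifN.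
Qed.

Lemma sum_block x : \sum_j linfun (@block_in j) (linfun (@block_out j) x) = x.
Proof.
under eq_bigr do rewrite !lfunE.
rewrite big_sumType /=; case: x => x y; apply: injective_projections.
  by rewrite raddfD !raddf_sum /= (sum_single x) big1 ?addr0.
by rewrite raddfD !raddf_sum /= (sum_single y) big1 ?add0r.
Qed.

Lemma dsum_pairE x y z w : Q x y z w =
  \sum_j block_form (linfun (@block_out j) x) (linfun (@block_out j) y)
           (linfun (@block_out j) z) (linfun (@block_out j) w).
Proof.
by under eq_bigr do rewrite !lfunE; rewrite big_sumType.
Qed.

(** Hence a sum with trivial kernel has summands with trivial kernel. *)
Lemma form4_ker_block_in j v :
    (forall i x y z, @block_form i 0 x y z = 0) ->
  form4_ker (@block_form j) v -> form4_ker Q (block_in v).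
Proof.
move=> T0 v0 x y z; rewrite dsum_pairE big1 // => i _.
rewrite -[block_in v]lfunE; have [->|ij] := eqVneq i j.
  by rewrite (block_inK v) v0.
by rewrite (block_out_in_neq v ij) T0.
Qed.

Hypotheses (U1_neq0 : exists w : U1, w != 0) (U2_neq0 : exists w : U2, w != 0).
Hypothesis dimU : \dim {: U1} <> \dim {: U2}.
Hypothesis T1P : forall x z,
  (forall y y', T1 x y y' z = 0) <-> (x == 0) || (z == 0).
Hypothesis T2P : forall x z,
  (forall y y', T2 x y y' z = 0) <-> (x == 0) || (z == 0).
Hypothesis T10 : forall x y z, T1 x 0 y z = 0.
Hypothesis T20 : forall x y z, T2 x 0 y z = 0.

Lemma pair_act_strgroup_surj (A : strgroup Q) :
  exists a, pair_act_strgroup a = A.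
Proof.
have A_inj : lker A == 0%VS := valP (val A).
have /asboolP AQ := valP A.
pose inj j : 'Hom(block_type j, V) := linfun (@block_in j).
pose prj j : 'Hom(V, block_type j) := linfun (@block_out j).
have injK j : cancel (inj j) (prj j) by exact: block_inK.
have neq i j w : i != j -> prj i (inj j w) = 0 by exact: block_out_in_neq.
have sumV x : \sum_j inj j (prj j x) = x by exact: sum_block.
have W0 j : exists w : block_type j, w != 0 by case: j.
have TP j (x z : block_type j) :
    (forall y y', block_form x y y' z = 0) <-> (x == 0) || (z == 0).
  by case: j x z.
have T0 j (x y z : block_type j) : block_form x 0 y z = 0 by case: j x y z.
have QE := dsum_pairE.
have [s sP] := isometry_perm_blocks injK neq sumV W0 TP QE T0 A_inj AQ.
have sD := isometry_perm_dim injK A_inj sP.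
(* The permutation respects the two types of blocks because dimensions differ. *)
have /fin_all_exists[s1 s1P] : forall i, exists l, s (inl i) = inl l.
  by move=> i; have := sD (inl i); case: (s (inl i)) => l; [exists l | move/esym].
have /fin_all_exists[s2 s2P] : forall i, exists l, s (inr i) = inr l.
  by move=> i; have := sD (inr i); case: (s (inr i)) => l; [ | exists l].
have s1_inj : injective s1.
  move=> i l il; have : s (inl i) = s (inl l) by rewrite !s1P il.
  by move/perm_inj => [].
have s2_inj : injective s2.
  move=> i l il; have : s (inr i) = s (inr l) by rewrite !s2P il.
  by move/perm_inj => [].
have QF j x y z w : Q (inj j x) (inj j y) (inj j z) (inj j w) = block_form x y z w.
  exact: (form_inj injK neq QE T0).
have [h1 h1P] : exists h : {ffun 'I_k1 -> strgroup T1}, forall i w,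
    A (inj (inl i) w) = inj (inl (perm s1_inj i)) (h (perm s1_inj i) w).
  apply: (@isometry_block_family _ _ _ _ (fun i => inj (inl i))
    (fun i => prj (inl i)) _ Q) => //.
  - by move=> i; exact: (injK (inl i)).
  - by move=> i x y z w; exact: (QF (inl i)).
  by move=> i w; have := sP (inl i) (inj (inl i) w); rewrite s1P injK permE.
have [h2 h2P] : exists h : {ffun 'I_k2 -> strgroup T2}, forall i w,
    A (inj (inr i) w) = inj (inr (perm s2_inj i)) (h (perm s2_inj i) w).
  apply: (@isometry_block_family _ _ _ _ (fun i => inj (inr i))
    (fun i => prj (inr i)) _ Q) => //.
  - by move=> i; exact: (injK (inr i)).
  - by move=> i x y z w; exact: (QF (inr i)).
  by move=> i w; have := sP (inr i) (inj (inr i) w); rewrite s2P injK permE.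
pose a := ((h1, perm s1_inj), (h2, perm s2_inj)).
have aE j w : pair_act a (inj j w) = A (inj j w).
  case: j w => i w.
    by rewrite h1P ![inj _ _]lfunE /pair_act /= wreath_act0 wreath_act_single.
  by rewrite h2P ![inj _ _]lfunE /pair_act /= wreath_act0 wreath_act_single.
exists a; apply: eq_strgroup => x; rewrite pair_act_strgroupE -(sumV x) !raddf_sum.
by apply: eq_bigr => j _; exact: aE.
Qed.

End TwoTypes.

Theorem corollary1p10 (R : realType) (W1 W2 : vectType R)
    (hW1 : (0 < \dim {: W1})%N) (hW2 : (0 < \dim {: W2})%N)
    (phi1 : {symmetric W1}) (phi2 : {symmetric W2})
    (hphi1 : nondegenerate phi1) (hphi2 : nondegenerate phi2)
    (k1 k2 : nat) (hk1 : (1 <= k1)%N) (hk2 : (1 <= k2)%N) :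
  let R1 : form4 {ffun 'I_k1 -> W1} := dsum_family (fun=> curv phi1) in
  let R2 : form4 {ffun 'I_k2 -> W2} := dsum_family (fun=> curv phi2) in
  let RV : form4 ({ffun 'I_k1 -> W1} * {ffun 'I_k2 -> W2})%type :=
    dsum_pair R1 R2 in
  form4_ker RV = [set 0]%classic ->
  \dim {: W1} <> \dim {: W2} ->
  isomorphic (strgroup RV)
    (wreath (strgroup (curv phi1)) k1 * wreath (strgroup (curv phi2)) k2)%type.
Proof.
move=> R1 R2 RV kerR dimW.
have neq0 (W : vectType R) : (0 < \dim {: W})%N -> exists w : W, w != 0.
  by rewrite lt0n dimv_eq0 => W0; exists (vpick {: W}); rewrite vpick0.
have curv0x (W : vectType R) (phi : {symmetric W}) x y z : curv phi x 0 y z = 0.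
  by rewrite /curv !linear0l !mulr0 subrr.
have curv0l (W : vectType R) (phi : {symmetric W}) x y z : curv phi 0 x y z = 0.
  by rewrite /curv !linear0l !mul0r subrr.
have kerB j (v : block_type W1 W2 j) :
    form4_ker (@block_form _ _ _ (curv phi1) (curv phi2) k1 k2 j) v -> v = 0.
  move=> v0; apply: block_in_eq0; have : form4_ker RV (block_in v).
    by apply: form4_ker_block_in v0 => -[] i x y z; apply: curv0l.
  by rewrite kerR.
have ker1 v : (forall x y z, curv phi1 v x y z = 0) -> v = 0.
  exact: (kerB (inl (Ordinal hk1))).
have ker2 v : (forall x y z, curv phi2 v x y z = 0) -> v = 0.
  exact: (kerB (inr (Ordinal hk2))).
apply: (isomorphic_bij (@pair_act_strgroupM _ _ _ _ _ _ _)).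
  by apply: pair_act_strgroup_inj; apply: neq0.
apply: pair_act_strgroup_surj => //;
  [exact: neq0 | exact: neq0 | exact: curv_eq0P ..].
Qed.
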